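(* Let $d\ge 10$ and let $h_1<h_2<\dots$ be a (finite or infinite, possibly empty) strictly increasing sequence of positive integers with $h_{i+1}-h_i\ge 6$ for all $i$. Then the lattice $L_d(h_1,h_2,\dots)$ is perfect and has minimum $4$.
   Context: For a strictly increasing (finite or infinite, possibly empty) sequence of positive integers $h_1<h_2<\dots$ (called holes) and an integer $d\ge1$, let $s_1<s_2<\dots<s_{d+2}$ be the $d+2$ smallest elements of $\{1,2,3,\dots\}\setminus\{h_1,h_2,\dots\}$, and define $L_d(h_1,h_2,\dots)=\{x\in\mathbb Z^{d+2}:\ \sum_{i=1}^{d+2}x_i=0,\ \sum_{i=1}^{d+2}s_ix_i=0\}$ with the standard inner product of $\mathbb R^{d+2}$; it is an even integral lattice of rank $d$. The minimum is the smallest squared Euclidean norm of a nonzero element. A lattice $L$ of rank $n$ is perfect if $\{v\otimes v\}$, $v$ ranging over its minimal vectors, spans the $\binom{n+1}{2}$-dimensional space of symmetric tensors in $(L\otimes\mathbb R)\otimes(L\otimes\mathbb R)$. *)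

(* Defs.v *)
From HB Require Import structures.
From mathcomp Require Import all_boot all_order all_algebra.
Set Implicit Arguments. Unset Strict Implicit. Unset Printing Implicit Defensive.
Import Order.TTheory GRing.Theory Num.Theory.
Local Open Scope ring_scope.

(* Holes are encoded as a boolean predicate H on nat (the set {h_1,h_2,...}),
   which covers finite, infinite and empty sequences.
   Holes are positive integers, and consecutive holes differ by at least 6. *)
Definition holes_ok (H : nat -> bool) : Prop :=
  ~~ H 0%N /\
  (forall a b : nat, H a -> H b -> (a < b)%N ->
     (forall c : nat, (a < c < b)%N -> ~~ H c) -> (6 <= b - a)%N).

(* s_1 < ... < s_n are the n smallest elements of {1,2,3,...} \ holes
   (indexed here by 'I_n, i.e. s (i-1) = s_i). *)
Definition smallest_nonholes (H : nat -> bool) (n : nat) (s : 'I_n -> nat) : Prop :=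
  (forall i j : 'I_n, (i < j)%N -> (s i < s j)%N) /\
  (forall i : 'I_n, (0 < s i)%N /\ ~~ H (s i)) /\
  (forall m : nat, (0 < m)%N -> ~~ H m -> (exists i : 'I_n, (m <= s i)%N) ->
     exists i : 'I_n, s i = m).

Definition inL (n : nat) (s : 'I_n -> nat) (x : 'rV[int]_n) : Prop :=
  \sum_(i < n) x 0 i = 0 /\ \sum_(i < n) (s i)%:Z * x 0 i = 0.

Definition norm2 (n : nat) (x : 'rV[int]_n) : int := \sum_(i < n) x 0 i ^+ 2.

Definition lattice_min (n : nat) (s : 'I_n -> nat) (m : int) : Prop :=
  (exists x, inL s x /\ x != 0 /\ norm2 x = m) /\
  (forall x, inL s x -> x != 0 -> m <= norm2 x).

Definition minimal_vector (n : nat) (s : 'I_n -> nat) (x : 'rV[int]_n) : Prop :=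
  inL s x /\ x != 0 /\ (forall y, inL s y -> y != 0 -> norm2 x <= norm2 y).

Definition outer (R : numFieldType) (n : nat) (v : 'rV[int]_n) : 'M[R]_n :=
  (map_mx (fun z : int => z%:~R) v)^T *m map_mx (fun z : int => z%:~R) v.

(* L (of rank r) is perfect: the tensors v (x) v, v minimal, span the
   'C(r+1,2)-dimensional space of symmetric tensors of L (x) R; since all
   v (x) v lie in that space, this means their span has dimension 'C(r+1,2),
   i.e. some finite family of minimal vectors gives that rank. *)
Definition perfect (R : numFieldType) (n : nat) (s : 'I_n -> nat) (r : nat) : Prop :=
  exists vs : seq 'rV[int]_n,
    (forall v, v \in vs -> minimal_vector s v) /\
    \rank (\matrix_(k < size vs) mxvec (outer R vs`_k)) = 'C(r.+1, 2).

(* Main.v *)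
(* The vectors e_a + e_b - e_c - e_d with a + b = c + d (coordinates being named
   after the non-holes) are the minimal ones.  It suffices to find 'C(d+1, 2) of
   them with linearly independent tensor squares, and we add the non-holes one
   at a time.  When a non-hole m is adjoined to n smaller ones, n - 1 = 'C(n, 2) -
   'C(n-1, 2) linearly independent minimal vectors containing e_m suffice: in a
   relation between tensor squares, the column of m involves only these vectors,
   and linearly.  Such vectors exist: a finite computation gives those supported
   on the window [m - 10, m], and below the window e_m + e_a - e_(a+i) - e_(m-i)
   with i = 1, 2 or 3 is triangular in a.  The induction starts at d = 10, where
   the finitely many cases are decided by Gaussian elimination. *)
Require Import Defs.
From HB Require Import structures.
From Stdlib Require Import ZArith.
From mathcomp Require Import all_boot all_order all_algebra.
From mathcomp Require Import ssrZ zify ring.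
Import Order.TTheory GRing.Theory Num.Theory.
Local Open Scope ring_scope.

(** * Linear independence and Gaussian elimination over the integers *)

Definition lin_indep {R : pzRingType} {T X : Type} (f : T -> X -> R) (qs : seq T) :=
  forall cs : seq R, size cs = size qs ->
    (forall x, \sum_(p <- zip cs qs) p.1 * f p.2 x = 0) -> all (pred1 0) cs.

Definition pivot (eqs : seq (seq Z)) : option (seq Z) :=
  ohead ([seq e <- eqs | Z.eqb (Z.abs (head Z0 e)) 1] ++
         [seq e <- eqs | ~~ Z.eqb (head Z0 e) 0]).

(* Dividing by the gcd, and preferring pivots [1] and [-1], keeps coefficients small. *)
Definition eliminate (p e : seq Z) : seq Z :=
  match e, p with
  | a :: e', b :: p' =>
      if Z.eqb a 0 then e' else
      let g := Z.gcd a b in let u := Z.div b g in let w := Z.div a g in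
      [seq (u * x.1 - w * x.2)%Z | x <- zip e' p']
  | _, _ => [::]
  end.

(* Each of the [eqs] lists the values of [n] vectors at one point; the result
   selects a maximal linearly independent subfamily. *)
Fixpoint pick (n : nat) (eqs : seq (seq Z)) : bitseq :=
  if n is n'.+1 then
    if pivot eqs is Some p then true :: pick n' [seq eliminate p e | e <- eqs]
    else false :: pick n' [seq behead e | e <- eqs]
  else [::].

Definition picked {T X : Type} (f : T -> X -> Z) (pts : seq X) (qs : seq T) : seq T :=
  mask (pick (size qs) [seq [seq f q x | q <- qs] | x <- pts]) qs.

(** * Quadruples, hole patterns and the finite checks *)

(* [((a, b), (c, d))] encodes [e_a + e_b - e_c - e_d]. *)
Definition quad : Type := (nat * nat) * (nat * nat).

Definition coord (q : quad) (x : nat) : Z :=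
  (Z.b2z (x == q.1.1) + Z.b2z (x == q.1.2) - Z.b2z (x == q.2.1) - Z.b2z (x == q.2.2))%Z.

Definition coord2 (q : quad) (xy : nat * nat) : Z := (coord q xy.1 * coord q xy.2)%Z.

Definition valid (S : seq nat) (q : quad) : bool :=
  let: ((a, b), (c, d)) := q in
  [&& all (mem S) [:: a; b; c; d], uniq [:: a; b; c; d] & a + b == c + d]%N.

(** With [a < b < c] and [m + a = b + c], [m] is the largest entry. If [m + a - b] truncates to 0,
    the test [b < c] fails. *)
Definition quads_from (S : seq nat) (m : nat) : seq quad :=
  [seq q <- [seq ((m, a), (b, m + a - b)%N) | a <- S, b <- S] |
    (q.1.2 < q.2.1 < q.2.2)%N && (q.2.2 \in S)].

(* Hole indicators of [k] consecutive integers compatible with gaps of at least [6]. *)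
Fixpoint patterns (k : nat) : seq bitseq :=
  if k is k'.+1 then
    [seq false :: p | p <- patterns k'] ++
    [seq true :: p | p <- patterns k' & ~~ has id (take 5 p)]
  else [:: [::]].

Definition unmasked (t : nat) (bs : bitseq) : seq nat := mask (map negb bs) (iota t (size bs)).

Definition window_quads (S : seq nat) : seq quad :=
  picked coord S (quads_from S 10).

(** Tensor squares are symmetric, so the entries with [y <= x] suffice. *)
Definition base_quads (S : seq nat) : seq quad :=
  picked coord2 [seq xy <- [seq (x, y) | x <- S, y <- S] | (xy.2 <= xy.1)%N]
    (flatten [seq quads_from S m | m <- S]).

(** The count [size S - 2] is the rank of the lattice on [S], the most that could be independent. *)
Definition window_check : bool :=
  all (fun bs => let S := rcons (unmasked 0 bs) 10%N in
     (size (window_quads S)).+2 == size S) (patterns 10).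

(** At most three holes precede the twelfth non-hole, so it lies in [[12, 15]]; [last] asks that it
    be the endpoint [M]. For [d = 10] the target is $\binom{11}{2}=55$. *)
Definition base_check : bool :=
  all (fun M => all (fun bs => let S := unmasked 1 bs in
     if (size S == 12) && ~~ last true bs then size (base_quads S) == 55 else true)
     (patterns M)) [:: 12; 13; 14; 15]%N.

(** * Soundness of the elimination *)

Lemma mem_pivot eqs p : pivot eqs = Some p -> p \in eqs /\ head Z0 p <> Z0.
Proof.
rewrite /pivot => piv.
have {piv}: p \in [seq e <- eqs | Z.eqb (Z.abs (head Z0 e)) 1] ++
                  [seq e <- eqs | ~~ Z.eqb (head Z0 e) 0].
  by case: (_ ++ _) piv => //= a l [->]; rewrite mem_head.
rewrite mem_cat !mem_filter => /orP[] /andP[h ->]; split=> //; lia.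
Qed.

Definition dot {R : pzRingType} (e : seq Z) (cs : seq R) : R :=
  \sum_(p <- zip cs e) p.1 * (int_of_Z p.2)%:~R.

Lemma dot_cons {R : pzRingType} a e (c : R) cs :
  dot (a :: e) (c :: cs) = c * (int_of_Z a)%:~R + dot e cs.
Proof. by rewrite /dot big_cons. Qed.

(** Elimination combines rows, so it commutes with the selection of columns by the mask [m]. *)
Lemma dot_mask_lin {R : comPzRingType} (u w : Z) m (e p : seq Z) (cs : seq R) :
  size e = size p ->
  dot (mask m [seq (u * x.1 - w * x.2)%Z | x <- zip e p]) cs =
  (int_of_Z u)%:~R * dot (mask m e) cs - (int_of_Z w)%:~R * dot (mask m p) cs.
Proof.
have nil_r v : @dot R v [::] = 0 by rewrite /dot; case: v => [|? ?]; rewrite big_nil.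
have nil_l (v : seq R) : dot [::] v = 0 by rewrite /dot; case: v => [|? ?]; rewrite big_nil.
elim: m e p cs => [|b0 m IH] [|a e] [|b p] cs //=; rewrite ?mask0 ?nil_l ?mulr0 ?subr0 // => -[/IH E].
case: b0 => //; case: cs => [|c cs]; first by rewrite !nil_r !mulr0 subr0.
rewrite !dot_cons E.
have -> : int_of_Z (u * a - w * b)%Z = int_of_Z u * int_of_Z a - int_of_Z w * int_of_Z b by lia.
rewrite rmorphB !rmorphM /=; ring.
Qed.

Lemma size_eliminate n p e : size p = n.+1 -> size e = n.+1 -> size (eliminate p e) = n.
Proof.
case: p e => [|b p] [|a e] //= [sp] [se]; case: ifP => _ //.
by rewrite size_map size_zip sp se minnn.
Qed.

(** Back substitution: the later coefficients solve the eliminated system and vanish by induction;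
    then the pivot equation, whose head is nonzero, kills the first one. *)
Lemma pick_sound {R : numDomainType} n (eqs : seq (seq Z)) (cs : seq R) :
  all (fun e => size e == n) eqs -> size cs = count id (pick n eqs) ->
  (forall e, e \in eqs -> dot (mask (pick n eqs) e) cs = 0) -> all (pred1 0) cs.
Proof.
elim: n eqs cs => [|n IH] eqs cs /allP sz /=; first by case: cs.
case piv: (pivot eqs) => [p|] /=; last first.
  rewrite add0n => scs h; apply: (IH _ _ _ scs) => [|e' /mapP[e ein ->]].
    by apply/allP => e' /mapP[e /sz /eqP se ->]; rewrite size_behead se.
  by move: (h _ ein) (sz _ ein); case: e {ein}.
have [pin p0] := mem_pivot _ _ piv.
have /eqP sp := sz _ pin.
case: cs => [|c cs] //=; rewrite add1n => -[scs] h.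
have cs0 : all (pred1 0) cs.
  apply: (IH _ _ _ scs) => [|e' /mapP[e ein ->]].
    by apply/allP => e' /mapP[e /sz /eqP se ->]; rewrite (size_eliminate n).
  have /eqP se := sz _ ein.
  move: (pick n _) scs h => m scs h.
  move: (h _ ein) (h _ pin) p0; case: e {ein} se => [|a e] //= [se].
  case: p {pin piv h scs} sp => [|b p] //= [sp]; rewrite !dot_cons => ha hb b0.
  case: Z.eqb_spec => [a0|_]; first by move: ha; rewrite a0 /= mulr0 add0r.
  rewrite dot_mask_lin ?se ?sp //.
  have gb := Z.gcd_divide_r a b; have ga := Z.gcd_divide_l a b.
  have g0 : Z.gcd a b <> Z0 by move/Z.gcd_eq_0; case.
  move: (Z.gcd a b) g0 ga gb => g g0 [k ak] [l bl].
  rewrite ak bl !Z.div_mul //.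
  (* Both tails are multiples of [c]; with [a = k g] and [b = l g] the combination is
     [c (k b - l a) = 0]. *)
  have -> : dot (mask m e) cs = - (c * (int_of_Z a)%:~R).
    by apply/eqP; rewrite -addr_eq0 addrC ha.
  have -> : dot (mask m p) cs = - (c * (int_of_Z b)%:~R).
    by apply/eqP; rewrite -addr_eq0 addrC hb.
  have -> : int_of_Z a = int_of_Z k * int_of_Z g by lia.
  have -> : int_of_Z b = int_of_Z l * int_of_Z g by lia.
  rewrite !rmorphM /=; ring.
rewrite cs0 andbT; move: (pick n _) scs h => m scs h; move: (h _ pin) p0.
case: p {pin piv h scs} sp => [|b p] //= _; rewrite dot_cons.
have -> : dot (mask m p) cs = 0.
  rewrite /dot big1_seq // => -[x y] /andP[_ /(map_f fst)] /=.
  move=> /= xin; suff: x \in cs by move/(allP cs0)/eqP=> ->; rewrite mul0r.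
  elim: cs (mask _ _) xin {cs0} => [|z cs IHc] [|w ms] //=; rewrite !inE => /orP[->//|/IHc ->].
  by rewrite orbT.
rewrite addr0 => /eqP; rewrite mulf_eq0 => /orP[//|].
rewrite intr_eq0 => /eqP b0 b1; exfalso; apply: b1; lia.
Qed.

Lemma size_pick n eqs : size (pick n eqs) = n.
Proof. by elim: n eqs => //= n IH eqs; case: (pivot _) => [p|] /=; rewrite IH. Qed.

Lemma dot_map {R : pzRingType} {T : Type} (g : T -> Z) qs (cs : seq R) :
  dot [seq g q | q <- qs] cs = \sum_(p <- zip cs qs) p.1 * (int_of_Z (g p.2))%:~R.
Proof.
rewrite /dot; elim: qs cs => [|q qs IH] [|c cs] /=; rewrite ?big_nil // !big_cons IH //.
Qed.

(** A relation holds at every point, while elimination only tests those in [pts]; hence any list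
    [pts] is sound. *)
Lemma picked_lin_indep {R : numDomainType} {T : Type} {X : eqType} (f : T -> X -> Z) pts qs :
  lin_indep (fun q x => (int_of_Z (f q x))%:~R : R) (picked f pts qs).
Proof.
move=> cs; rewrite /picked; set eqs := [seq _ | x <- pts] => scs h.
apply: (pick_sound (size qs) eqs).
- by apply/allP => e /mapP[x _ ->]; rewrite size_map.
- by rewrite scs size_mask // size_pick.
by move=> e /mapP[x _ ->]; rewrite -map_mask dot_map.
Qed.

(** * Transfer and assembly of independent families *)

Lemma eq_sum_zip {R : pzRingType} {T : eqType} (f g : T -> R) (cs : seq R) qs :
  {in qs, f =1 g} -> \sum_(p <- zip cs qs) p.1 * f p.2 = \sum_(p <- zip cs qs) p.1 * g p.2.
Proof.
elim: qs cs => [|q qs IH] [|c cs] fg /=; rewrite ?big_nil // !big_cons /= fg ?mem_head //.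
by rewrite IH // => q' qs_q'; apply: fg; rewrite inE qs_q' orbT.
Qed.

Lemma lin_indep_map {R : pzRingType} {T T' X X' : Type} (f : T -> X -> R) (f' : T' -> X' -> R)
    (h : T -> T') (k : X -> X') qs :
  (forall q x, f' (h q) (k x) = f q x) -> lin_indep f qs -> lin_indep f' (map h qs).
Proof.
move=> fE ind cs; rewrite size_map => scs rel; apply: ind => // x.
rewrite -[RHS](rel (k x)) {rel}.
elim: qs cs scs => [|q qs IH] [|c cs] //= => [_|[/IH E]]; rewrite ?big_nil // !big_cons E /= fE //.
Qed.

(** Triangularity: evaluation at [x] isolates the coefficient of [q]. *)
Lemma lin_indep_cons {R : idomainType} {T : eqType} {X : Type} (f : T -> X -> R) q qs x :
  f q x != 0 -> {in qs, forall q', f q' x = 0} -> lin_indep f qs -> lin_indep f (q :: qs).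
Proof.
move=> fq fqs ind [|c cs] //= [scs] rel.
have tail0 : \sum_(p <- zip cs qs) p.1 * f p.2 x = 0.
  by rewrite (eq_sum_zip (f^~ x) (fun=> 0)) // big1 // => p _; rewrite mulr0.
have c0 : c == 0.
  by have /eqP := rel x; rewrite big_cons tail0 addr0 mulf_eq0 (negbTE fq) orbF.
rewrite c0 ind // => y; have := rel y.
by rewrite big_cons (eqP c0) mul0r add0r.
Qed.

(* In a relation between the squares, the column of [m] is a linear relation
   between the elements of [ws] alone. *)
Lemma lin_indep_squares_cat {R : pzRingType} {T : eqType} {X : Type} (f : T -> X -> R) ws qs m :
  {in ws, forall w, f w m = 1} -> {in qs, forall q, f q m = 0} ->
  lin_indep f ws -> lin_indep (fun q xy => f q xy.1 * f q xy.2) qs ->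
  lin_indep (fun q xy => f q xy.1 * f q xy.2) (ws ++ qs).
Proof.
move=> fws fqs indw indq cs scs rel.
rewrite size_cat in scs.
have [cw [cq [csE sw sq]]] : exists cw cq, [/\ cs = cw ++ cq, size cw = size ws & size cq = size qs].
  exists (take (size ws) cs), (drop (size ws) cs).
  by rewrite cat_take_drop size_drop size_takel scs ?leq_addr // addKn.
rewrite csE in rel *.
have {}rel xy : \sum_(p <- zip cw ws) p.1 * (f p.2 xy.1 * f p.2 xy.2) +
              \sum_(p <- zip cq qs) p.1 * (f p.2 xy.1 * f p.2 xy.2) = 0.
  by have := rel xy; rewrite zip_cat // big_cat.
have cw0 : all (pred1 0) cw.
  apply: indw => // x; have := rel (x, m).
  rewrite (eq_sum_zip (fun q => f q x * f q m) (f^~ x)) => [|q /fws -> /=]; last by rewrite mulr1.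
  rewrite (eq_sum_zip (fun q => f q x * f q m) (fun=> 0)) => [|q /fqs -> /=]; last by rewrite mulr0.
  by rewrite [X in _ + X]big1 ?addr0 // => p _; rewrite mulr0.
rewrite all_cat cw0 indq // => xy; have := rel xy.
rewrite big1_seq ?add0r // => -[c w] /= /(map_f fst) /=.
rewrite -/(unzip1 _) unzip1_zip ?sw // => /(allP cw0) /eqP -> /=; exact: mul0r.
Qed.

(** * Translation and support of quadruples *)

Definition shift (t : nat) (q : quad) : quad :=
  ((t + q.1.1, t + q.1.2), (t + q.2.1, t + q.2.2))%N.

Lemma coord_shift t q x : coord (shift t q) (t + x) = coord q x.
Proof. by rewrite /coord /= !eqn_add2l. Qed.

Lemma valid_shift t S q : valid S q -> valid [seq (t + x)%N | x <- S] (shift t q).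
Proof.
case: q => [[a b] [c d]] /and3P[/allP inS uq /eqP abcd]; apply/and3P; split=> /=.
- by rewrite !(map_f (addn t)) // ; apply: inS; rewrite !inE eqxx ?orbT.
- by move: uq; rewrite /= !inE !eqn_add2l.
- by rewrite addnACA [X in _ == X]addnACA abcd.
Qed.

Lemma valid_subset S S' q : {subset S <= S'} -> valid S q -> valid S' q.
Proof.
by case: q => [[a b] [c d]] sub /and3P[/allP inS uq abcd]; apply/and3P; split=> //; apply/allP => x /inS /sub.
Qed.

Lemma coord_notin S q x : valid S q -> x \notin S -> coord q x = Z0.
Proof.
case: q => [[a b] [c d]] /and3P[/allP inS _ _] xS.
have ne y : y \in [:: a; b; c; d] -> (x == y) = false.
  by move=> /inS yS; apply: contraNF xS => /eqP ->.
by rewrite /coord /= !ne // !inE eqxx ?orbT.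
Qed.

Lemma coord_head S q : valid S q -> coord q q.1.1 = Zpos xH.
Proof.
case: q => [[a b] [c d]] /and3P[_ /= ]; rewrite !inE !negb_or => /andP[/and3P[ab ac ad] _] _.
by rewrite /coord /= eqxx (negbTE ab) (negbTE ac) (negbTE ad).
Qed.

Lemma quads_fromP S m q : m \in S -> q \in quads_from S m -> valid S q /\ q.1.1 = m.
Proof.
move=> mS; rewrite mem_filter => /andP[/andP[/andP[ab bc] cS] /allpairsP[[a b] [aS bS qE]]].
move: ab bc cS; rewrite {}qE /= in aS bS *; move=> ab bc cS; split=> //; apply/and3P; split=> /=.
- by rewrite mS aS bS cS.
- by rewrite !inE; lia.
- lia.
Qed.

Lemma mem_picked {T X : eqType} (f : T -> X -> Z) pts qs q : q \in picked f pts qs -> q \in qs.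
Proof. exact: mem_mask. Qed.

(** * Non-holes in an interval *)

Definition nonholes (H : nat -> bool) (t k : nat) : seq nat := [seq x <- iota t k | ~~ H x].

Definition gapped (H : nat -> bool) : Prop :=
  forall a b, H a -> H b -> (a < b)%N -> (6 <= b - a)%N.

Lemma patternsP H t k : gapped H -> [seq H x | x <- iota t k] \in patterns k.
Proof.
move=> gapH; elim: k t => [|k IH] t //=; rewrite mem_cat.
case Ht: (H t); apply/orP; [right|left]; apply/mapP; exists [seq H x | x <- iota t.+1 k] => //.
rewrite mem_filter IH andbT -map_take take_iota has_map; apply/hasPn => x /=.
rewrite mem_iota => xin; apply/negP => Hx.
by have := gapH _ _ Ht Hx; lia.
Qed.

Lemma nonholes_unmasked H t k : nonholes H t k = unmasked t [seq H x | x <- iota t k].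
Proof. by rewrite /nonholes /unmasked filter_mask size_map size_iota -map_comp. Qed.

Lemma unmasked_shift t bs : unmasked t bs = [seq (t + x)%N | x <- unmasked 0 bs].
Proof. by rewrite /unmasked map_mask -iotaDl addn0. Qed.

Lemma nonholesS H t k :
  nonholes H t k.+1 = if H t then nonholes H t.+1 k else t :: nonholes H t.+1 k.
Proof. by rewrite /nonholes /=; case: (H t). Qed.

Lemma mem_nonholes H t k x : (x \in nonholes H t k) = ~~ H x && (t <= x < t + k)%N.
Proof. by rewrite mem_filter mem_iota. Qed.

Lemma window_ok : window_check.
Proof. by vm_compute. Qed.

Lemma base_ok : base_check.
Proof. by vm_compute. Qed.

(** Holes six apart leave at most three holes among 15 consecutive integers. *)
Lemma nonholes_upto15 H : gapped H -> (12 <= size (nonholes H 1 15))%N.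
Proof.
move=> gapH; rewrite nonholes_unmasked.
have /allP : all (fun bs => 12 <= size (unmasked 1 bs))%N (patterns 15) by vm_compute.
by apply; apply: patternsP.
Qed.

(** * Independent vectors through the largest non-hole *)

Definition coordR (R : pzRingType) (q : quad) (x : nat) : R := (int_of_Z (coord q x))%:~R.

(** The hole pattern on [[m - 10, m - 1]] is among those checked; translation by [m - 10] carries
    the vectors found on [[0, 10]] to the window. *)
Lemma top_window (R : numDomainType) H m : gapped H -> ~~ H m -> (10 <= m)%N ->
  exists ws, [/\ {in ws, forall q, valid (nonholes H (m - 10) 11) q /\ q.1.1 = m},
                 (size ws).+2 = size (nonholes H (m - 10) 11) & lin_indep (coordR R) ws].
Proof.
move=> gapH Hm m10; set t := (m - 10)%N.
have tm : (t + 10 = m)%N by rewrite subnK.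
set bs := [seq H x | x <- iota t 10].
set S := rcons (unmasked 0 bs) 10.
have nhE : nonholes H t 11 = [seq (t + x)%N | x <- S].
  rewrite /S map_rcons -unmasked_shift -nonholes_unmasked tm.
  by rewrite /nonholes -[11%N]/(10 + 1)%N iotaD filter_cat /= tm Hm cats1.
exists (map (shift t) (window_quads S)); split.
- move=> _ /mapP[q /mem_picked qin ->]; rewrite nhE.
  have S10 : 10%N \in S by rewrite mem_rcons mem_head.
  have [qval q1] := quads_fromP _ _ _ S10 qin.
  by split; [exact: valid_shift | rewrite /= q1 tm].
- rewrite nhE !size_map; apply/eqP; move/allP: window_ok; apply; exact: patternsP.
apply: (lin_indep_map _ _ _ (addn t) _ _ (picked_lin_indep _ _ _)) => q x.
by rewrite /coordR coord_shift.
Qed.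

(* As holes are six apart, one of [i = 1, 2, 3] makes both [a + i] and [m - i]
   available, and [m, a, a + i, m - i] is triangular in [a]. *)
Lemma quad_below H m a : gapped H -> ~~ H m -> ~~ H a -> (0 < a)%N -> (a + 10 < m)%N ->
  exists q, [/\ valid (nonholes H a (m - a).+1) q, q.1.1 = m & coord q a = Zpos xH].
Proof.
move=> gapH Hm Ha a0 am.
(* Each end has at most one hole among its three candidates, so at most two of the three values of
   [i] are excluded. *)
have [i [i0 i3 Hai Hmi]] : exists i, [/\ (0 < i)%N, (i <= 3)%N, ~~ H (a + i)%N & ~~ H (m - i)%N].
  have nogap b c : (b < c < b + 6)%N -> H b -> H c -> False.
    by move=> bc Hb Hc; have := gapH _ _ Hb Hc; lia.
  case A1: (H (a + 1)%N); last case M1: (H (m - 1)%N); last by exists 1%N; rewrite A1 M1.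
  - have A2 : ~~ H (a + 2)%N by apply/negP; apply: nogap A1; lia.
    have A3 : ~~ H (a + 3)%N by apply/negP; apply: nogap A1; lia.
    case M2: (H (m - 2)%N); last by exists 2%N; rewrite A2 M2.
    by exists 3%N; split=> //; apply/negP => M3; apply: nogap M3 M2; lia.
  have M2 : ~~ H (m - 2)%N by apply/negP => M2; apply: nogap M2 M1; lia.
  have M3 : ~~ H (m - 3)%N by apply/negP => M3; apply: nogap M3 M1; lia.
  case A2: (H (a + 2)%N); last by exists 2%N; rewrite A2 M2.
  by exists 3%N; split=> //; apply/negP; apply: nogap A2; lia.
exists ((m, a), (a + i, m - i))%N; split=> //; last first.
  have [am' ai ami] : [/\ a != m, a != (a + i)%N & a != (m - i)%N] by split; lia.
  by rewrite /coord /= eqxx (negbTE am') (negbTE ai) (negbTE ami).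
apply/and3P; split=> /=; last lia.
- by rewrite !mem_nonholes Hm Ha Hai Hmi; lia.
- by rewrite !inE; lia.
Qed.

(** The window grows downward. A hole changes nothing; a new non-hole [t] brings one quadruple
    containing [t], where all earlier ones vanish. The bound [j + 10 < m] keeps [t] positive. *)
Lemma top_quads (R : numDomainType) H m j : gapped H -> ~~ H m -> (j + 10 < m)%N ->
  let S := nonholes H (m - 10 - j) (11 + j) in
  exists ws, [/\ {in ws, forall q, valid S q /\ q.1.1 = m},
                 (size ws).+2 = size S & lin_indep (coordR R) ws].
Proof.
move=> gapH Hm; elim: j => [|j IH] jm.
  by rewrite subn0 addn0; apply: top_window => //; lia.
have [|ws [wsin wsz ind]] := IH; first lia.
have tE : (m - 10 - j = (m - 10 - j.+1).+1)%N by lia.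
set t := (m - 10 - j.+1)%N in tE *; rewrite {}tE in wsin wsz *.
rewrite addnS nonholesS; case Ht: (H t) => /=; first by exists ws.
have [|||q [qval q1 qt]] := quad_below _ _ t gapH Hm; [by rewrite Ht | lia | lia |].
exists (q :: ws); split.
- move=> q'; rewrite inE => /orP[/eqP -> | /wsin[q'val q'1]]; split=> //.
    by move: qval; rewrite (_ : (m - t).+1 = (11 + j).+1) ?nonholesS ?Ht //; lia.
  by apply: valid_subset q'val => x xin; rewrite inE xin orbT.
- by rewrite /= -wsz.
apply: (lin_indep_cons _ _ _ t) ind => [|q' /wsin[q'val _]]; first by rewrite /coordR qt oner_eq0.
by rewrite /coordR (coord_notin _ _ _ q'val) // mem_nonholes; lia.
Qed.

(** * Independent tensor squares, by induction over the non-holes *)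

Definition squares_basis (R : pzRingType) (S : seq nat) : Prop :=
  exists qs, [/\ all (valid S) qs, size qs = 'C((size S).-1, 2) &
                 lin_indep (fun q xy => coordR R q xy.1 * coordR R q xy.2) qs].

Lemma nonholes_cat H t k l : nonholes H t (k + l) = nonholes H t k ++ nonholes H (t + k) l.
Proof. by rewrite /nonholes iotaD filter_cat. Qed.

Lemma squares_basis_base (R : numDomainType) H M : gapped H -> ~~ H M ->
  size (nonholes H 1 M) = 12%N -> squares_basis R (nonholes H 1 M).
Proof.
move=> gapH HM szS.
have M12 : (12 <= M)%N.
  by rewrite -szS size_filter -[leqRHS](size_iota 1); apply: count_size.
(* Beyond 15, the twelve non-holes in [[1, 15]] together with [M] would be thirteen. *)
have M15 : (M <= 15)%N.
  rewrite leqNgt; apply/negP => M15.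
  have := nonholes_upto15 H gapH; move: szS.
  have ME : (M = 15 + (M - 16) + 1)%N by lia.
  rewrite [in nonholes _ _ _]ME !nonholes_cat !size_cat (_ : 1 + (15 + (M - 16)) = M)%N; last lia.
  by rewrite [nonholes H M 1]/nonholes /= HM /=; lia.
exists (base_quads (nonholes H 1 M)); split.
- apply/allP => q /mem_picked /flattenP[qs /mapP[m mS ->] qin].
  by have [] := quads_fromP _ _ _ mS qin.
- rewrite szS; apply/eqP.
  have Min : M \in [:: 12; 13; 14; 15]%N by rewrite !inE; lia.
  have /allP /(_ _ Min) /allP := base_ok.
  move=> /(_ _ (patternsP H 1 M gapH)); cbv beta zeta.
  rewrite -nonholes_unmasked szS eqxx andTb.
  have -> : last true [seq H x | x <- iota 1 M] = false.
    rewrite -(ltn_predK M12) -[_.-1.+1]addn1 iotaD map_cat last_cat /= add1n.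
    by rewrite (ltn_predK M12); exact: negbTE.
  by move=> /eqP ->.
move=> cs scs rel; apply: (picked_lin_indep coord2 _ _ _ scs) => xy.
rewrite -[RHS](rel xy); apply: eq_bigr => p _.
by rewrite /coordR -rmorphM /coord2 (rmorphM int_of_Z).
Qed.

Lemma squares_basis_nonholes (R : numDomainType) H M : gapped H ->
  (12 <= size (nonholes H 1 M))%N -> squares_basis R (nonholes H 1 M).
Proof.
move=> gapH; elim: M => [|M IH] //.
case HM: (H M.+1).
  by rewrite -(addn1 M) nonholes_cat add1n nonholesS HM cats0.
rewrite leq_eqVlt => /orP[/eqP sz12 | sz13].
  by apply: squares_basis_base => //; rewrite HM.
have SE : nonholes H 1 M.+1 = rcons (nonholes H 1 M) M.+1.
  by rewrite -{1}(addn1 M) nonholes_cat add1n nonholesS HM cats1.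
have M12 : (12 <= M)%N.
  have := count_size (fun x => ~~ H x) (iota 1 M.+1); rewrite size_iota -size_filter -/(nonholes H 1 M.+1). lia.
have [|qs [qsval qssz qsind]] := IH; first by move: sz13; rewrite SE size_rcons ltnS.
(* The choice [j = M - 10] extends the window to all of [[1, M + 1]]. *)
have [||ws [wsval wssz wsind]] := top_quads R H M.+1 (M - 10) gapH; [by rewrite HM | lia |].
rewrite (_ : M.+1 - 10 - (M - 10) = 1)%N in wsval wssz; last lia.
rewrite (_ : 11 + (M - 10) = M.+1)%N in wsval wssz; last lia.
exists (ws ++ qs); split.
- rewrite all_cat; apply/andP; split; apply/allP => q; first by case/wsval.
  by move=> /(allP qsval); apply: valid_subset => x; rewrite SE mem_rcons inE orbC => ->.
- rewrite size_cat qssz; move: wssz; rewrite SE size_rcons /=.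
  move: sz13; rewrite SE size_rcons; case: (size _) => [|n] //= _ [->].
  (* Pascal's rule: [n] new vectors raise $\binom n2$ to $\binom{n+1}2$. *)
  by rewrite binS bin1 addnC.
apply: (lin_indep_squares_cat _ _ _ M.+1) => //.
- move=> w /wsval[wv w1]; rewrite /coordR -w1 (coord_head _ _ wv) //.
- move=> q /(allP qsval) qv; rewrite /coordR (coord_notin _ _ _ qv) // mem_nonholes; lia.
Qed.

(** * The gap condition and the lower bound on the norm *)

(** Strong induction on the distance: a hole strictly between [a] and [b] is already at least 6 away
    from [a]. *)
Lemma holes_ok_gapped H : holes_ok H -> gapped H.
Proof.
move=> [_ gapH] a b; have [n] := ubnP (b - a).
elim: n b => // n IH b ltn Ha Hb ab.
have [/hasP[c cin Hc] | nohole] := boolP (has H (iota a.+1 (b - a).-1)).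
  rewrite mem_iota in cin.
  by have := IH c _ Ha Hc _; lia.
apply: gapH => // c ac; apply: (hasPn nohole); rewrite mem_iota; lia.
Qed.

(** A support of one or two coordinates is impossible as the weights are distinct; among three
    nonzero coordinates two share a sign. *)
Lemma norm2_ge4 {n : nat} (s : 'I_n -> nat) (x : 'rV[int]_n) :
  injective s -> inL s x -> x != 0 -> 4 <= norm2 x.
Proof.
move=> s_inj [sum0 wsum0] x0.
have [i xi] : exists i, x 0 i != 0.
  apply/existsP; apply: contra_neqT x0 => /existsPn x0.
  by apply/rowP => i; rewrite mxE; apply/eqP; have := x0 i; rewrite negbK.
have [j /andP[ji xj]] : exists j, (j != i) && (x 0 j != 0).
  apply/existsP; apply: contraNT xi => /existsPn others.
  apply/eqP; rewrite -{}sum0 (bigD1 i) //= big1 ?addr0 // => j ji.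
  by apply/eqP; have := others j; rewrite ji negbK.
have [k /and3P[ki kj xk]] : exists k, [&& k != i, k != j & x 0 k != 0].
  apply/existsP; apply: contraNT xi => /existsPn others.
  have x0k k : (k != i) && (k != j) -> x 0 k = 0.
    by move=> /andP[ki kj]; apply/eqP; have := others k; rewrite ki kj negbK.
  (* On a support inside [{i, j}], [x_i = - x_j] and the weighted sum is [(s_j - s_i) x_j]. *)
  move: sum0 wsum0; rewrite (bigD1 i) //= (bigD1 j) //= big1 //.
  rewrite (bigD1 i) //= (bigD1 j) //= big1 => [|k /x0k ->]; last exact: mulr0.
  rewrite !addr0 => /eqP; rewrite addr_eq0 => /eqP xij /eqP.
  rewrite xij mulrN addrC subr_eq0 -subr_eq0 -mulrBl mulf_eq0 subr_eq0 (negbTE xj) orbF.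
  by rewrite eqz_nat => /eqP /s_inj E; rewrite E eqxx in ji.
(* [norm2 x] is the sum of the nonnegative [x_i (x_i + e)], where terms of sign [e] count at least 2. *)
have same_sign (e : int) p q : e * e = 1 -> p != q -> 1 <= e * x 0 p -> 1 <= e * x 0 q -> 4 <= norm2 x.
  move=> e1 pq xp xq.
  have e_pm : e = 1 \/ e = -1 by nia.
  have term_ge0 l : 0 <= x 0 l ^+ 2 + e * x 0 l by case: e_pm => ->; nia.
  have term_ge2 l : 1 <= e * x 0 l -> 2 <= x 0 l ^+ 2 + e * x 0 l by case: e_pm => ->; nia.
  have -> : norm2 x = \sum_l (x 0 l ^+ 2 + e * x 0 l) by rewrite big_split /= -mulr_sumr sum0 mulr0 addr0.
  rewrite (bigD1 p) //= (bigD1 q) 1?eq_sym //= addrA -[4]addr0 lerD ?sumr_ge0 //.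
  exact: lerD (term_ge2 _ xp) (term_ge2 _ xq).
have sgn l : x 0 l != 0 -> (1 <= 1 * x 0 l) || (1 <= -1 * x 0 l) by lia.
have [ij [ik jk]] : i != j /\ i != k /\ j != k by rewrite eq_sym ji eq_sym ki eq_sym kj.
have one : (1 : int) * 1 = 1 by []. have mone : (-1 : int) * -1 = 1 by [].
by case/orP: (sgn i xi) => hi; case/orP: (sgn j xj) => hj; case/orP: (sgn k xk) => hk;
  solve [ exact: (same_sign _ _ _ one ij hi hj) | exact: (same_sign _ _ _ one ik hi hk)
        | exact: (same_sign _ _ _ one jk hj hk) | exact: (same_sign _ _ _ mone ij hi hj)
        | exact: (same_sign _ _ _ mone ik hi hk) | exact: (same_sign _ _ _ mone jk hj hk)].
Qed.

(** * Quadruples as minimal vectors *)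

Definition quad_row {n : nat} (s : 'I_n -> nat) (q : quad) : 'rV[int]_n :=
  \row_i int_of_Z (coord q (s i)).

Lemma coord_int q x : int_of_Z (coord q x) =
  (x == q.1.1)%:Z + (x == q.1.2)%:Z - (x == q.2.1)%:Z - (x == q.2.2)%:Z.
Proof. by rewrite /coord; do 4 case: eqP => _. Qed.

(** Used three times: [F = 1] and [F] the identity give the two equations of the lattice, and [F]
    the coordinate function of [q] itself gives its norm. *)
Lemma sum_coord {n : nat} (s : 'I_n -> nat) (F : nat -> int) q :
  injective s -> valid (codom s) q ->
  \sum_i F (s i) * int_of_Z (coord q (s i)) = F q.1.1 + F q.1.2 - F q.2.1 - F q.2.2.
Proof.
move=> s_inj; case: q => [[a b] [c d]] /and3P[/allP inS _ _] /=.
have pick1 y : y \in [:: a; b; c; d] -> \sum_i F (s i) * (s i == y)%:Z = F y.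
  move=> /inS /codomP[j ->]; rewrite (bigD1 j) //= eqxx mulr1 big1 ?addr0 // => i ij.
  by rewrite (inj_eq s_inj) (negbTE ij) mulr0.
rewrite -[F a]pick1 ?inE ?eqxx // -[F b]pick1 ?inE ?eqxx ?orbT //.
rewrite -[F c]pick1 ?inE ?eqxx ?orbT // -[F d]pick1 ?inE ?eqxx ?orbT //.
rewrite -big_split -!sumrB; apply: eq_bigr => i _.
by rewrite coord_int /=; ring.
Qed.

Lemma quad_row_inL {n : nat} (s : 'I_n -> nat) q :
  injective s -> valid (codom s) q -> inL s (quad_row s q).
Proof.
move=> s_inj qv; have /and3P[_ _ /eqP abcd] : valid (codom s) ((q.1.1, q.1.2), (q.2.1, q.2.2)).
  by case: q qv => [[? ?] [? ?]].
split.
  rewrite -[RHS](_ : 1 + 1 - 1 - 1 = 0) // -(sum_coord s (fun=> 1) q) //.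
  by apply: eq_bigr => i _; rewrite mxE mul1r.
transitivity (\sum_i (s i)%:Z * int_of_Z (coord q (s i))).
  by apply: eq_bigr => i _; rewrite mxE.
rewrite (sum_coord s Posz q) //; lia.
Qed.

Lemma norm2_quad_row {n : nat} (s : 'I_n -> nat) q :
  injective s -> valid (codom s) q -> norm2 (quad_row s q) = 4.
Proof.
move=> s_inj qv.
transitivity (\sum_i int_of_Z (coord q (s i)) * int_of_Z (coord q (s i))).
  by apply: eq_bigr => i _; rewrite mxE expr2.
rewrite (sum_coord s (fun x => int_of_Z (coord q x)) q) //.
case: q qv => [[a b] [c d]] /and3P[_ uq _]; rewrite !coord_int /=.
move: uq => /=; rewrite !inE !negb_or => /andP[/and3P[ab ac ad] /andP[/andP[bc bd] /andP[cd _]]].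
rewrite !eqxx (eq_sym b a) (eq_sym c a) (eq_sym d a) (eq_sym c b) (eq_sym d b) (eq_sym d c).
by rewrite (negbTE ab) (negbTE ac) (negbTE ad) (negbTE bc) (negbTE bd) (negbTE cd).
Qed.

Lemma quad_row_minimal {n : nat} (s : 'I_n -> nat) q :
  injective s -> valid (codom s) q -> minimal_vector s (quad_row s q).
Proof.
move=> s_inj qv; split; first exact: quad_row_inL.
rewrite norm2_quad_row //; split=> [|y yL y0]; last exact: norm2_ge4 yL y0.
apply/eqP => q0; have := norm2_quad_row _ _ s_inj qv; rewrite q0 /norm2 big1 // => i _.
by rewrite mxE expr0n.
Qed.

(** Full row rank means a trivial left kernel, and a kernel vector is a relation between the tensor
    squares. *)
Lemma rank_outer (R : numFieldType) {n : nat} (s : 'I_n -> nat) (qs : seq quad) :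
  all (valid (codom s)) qs ->
  lin_indep (fun q xy => coordR R q xy.1 * coordR R q xy.2) qs ->
  let vs := map (quad_row s) qs in
  \rank (\matrix_(k < size vs) mxvec (outer R vs`_k)) = size qs.
Proof.
move=> qsv ind vs; rewrite -[RHS](size_map (quad_row s)) -/vs; apply/eqP.
rewrite -[_ == _]/(row_free _); apply: inj_row_free => u uA0.
set cs := [seq u 0 k | k <- enum 'I_(size vs)].
have szcs : size cs = size qs by rewrite size_map size_enum_ord size_map.
have cs0 : all (pred1 0) cs.
  apply: ind => // -[x y] /=.
  (* Away from the values of [s] every coordinate vanishes, so only pairs [(s i, s j)] matter; there
     the relation is the [(i, j)] entry of [uA0]. *)
  have off z : z \notin codom s -> {in qs, forall q, coordR R q z = 0}.
    by move=> zS q /(allP qsv) qv; rewrite /coordR (coord_notin _ _ _ qv).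
  have [/codomP[i ->] | xS] := boolP (x \in codom s); last first.
    rewrite (eq_sum_zip (fun q => coordR R q x * coordR R q y) (fun=> 0)).
      by rewrite big1 // => p _; rewrite mulr0.
    by move=> q qin; rewrite /= off // mul0r.
  have [/codomP[j ->] | yS] := boolP (y \in codom s); last first.
    rewrite (eq_sum_zip (fun q => coordR R q (s i) * coordR R q y) (fun=> 0)).
      by rewrite big1 // => p _; rewrite mulr0.
    by move=> q qin; rewrite /= [X in _ * X]off // mulr0.
  have := congr1 (fun v : 'rV_(n * n) => v 0 (mxvec_index i j)) uA0; rewrite !mxE => rel; rewrite -[RHS]rel {rel}.
  pose q0 : quad := ((0, 0), (0, 0))%N.
  rewrite (big_nth (0, q0)) size_zip szcs minnn -(size_map (quad_row s)) big_mkord.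
  apply: eq_bigr => k _; rewrite !mxE mxvecE nth_zip //=.
  have kqs : (k < size qs)%N by rewrite -(size_map (quad_row s)).
  rewrite (nth_map k) ?size_enum_ord // nth_ord_enum (nth_map q0) //.
  by rewrite !mxE big_ord1 !mxE.
apply/rowP => k; rewrite mxE; apply/eqP.
by apply: (allP cs0 (u 0 k)); apply: map_f; rewrite mem_enum.
Qed.

(** * Perfection and minimum of $L_d$ *)

Theorem theorem3p1 (R : realFieldType) (d : nat) (H : nat -> bool)
    (s : 'I_(d.+2) -> nat) :
  (10 <= d)%N -> holes_ok H -> smallest_nonholes H s ->
  perfect R s d /\ lattice_min s 4.
Proof.
move=> d10 /holes_ok_gapped gapH [s_mono [s_nonhole s_smallest]].
have s_inj : injective s.
  move=> i j sij; apply/val_inj; apply/eqP; case: ltngtP => // /s_mono; rewrite sij ltnn //.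
set S := nonholes H 1 (s ord_max).
(* Minimality of the [s i] makes their values exactly the non-holes up to the largest of them. *)
have memS : S =i codom s.
  move=> x; rewrite mem_nonholes add1n ltnS; apply/idP/codomP => [/and3P[Hx x0 xM]|[i ->]].
    have [|i <-] := s_smallest x x0 Hx; first by exists ord_max.
    by exists i.
  have [si0 Hsi] := s_nonhole i; rewrite Hsi si0 /=.
  have [im | mi] := ltnP i (@ord_max d.+1); first exact/ltnW/s_mono.
  rewrite (_ : i = ord_max) //; apply/val_inj/eqP.
  by rewrite eqn_leq mi leq_ord.
have szS : size S = d.+2.
  rewrite -[RHS](card_ord d.+2) -(size_codom s); apply/perm_size/uniq_perm => //.
    exact/filter_uniq/iota_uniq.
  exact/injectiveP.
have [|qs [qsv szqs ind]] := squares_basis_nonholes R H (s ord_max) gapH.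
  by rewrite -/S szS.
have {}qsv : all (valid (codom s)) qs.
  by apply/allP => q /(allP qsv); apply: valid_subset => x; rewrite memS.
rewrite -/S szS in szqs.
split.
  exists (map (quad_row s) qs); split; last by rewrite rank_outer.
  by move=> _ /mapP[q /(allP qsv) qv ->]; apply: quad_row_minimal.
split=> [|x]; last exact: norm2_ge4.
(* Since $\binom{d+1}{2}>0$, the list is nonempty, and its first member attains the norm 4. *)
case: qs qsv szqs {ind} => [|q qs] /= => [_ sz0|/andP[qv _] _].
  by have := bin_gt0 d.+1 2; rewrite -sz0 ltnS (leq_trans _ d10).
have [qL [q0 _]] := quad_row_minimal _ _ s_inj qv.
by exists (quad_row s q); rewrite norm2_quad_row.
Qed.
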